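(* For all $k\geq 3$ and all $m,n\in\mathbb{Z}^+$ with $1\leq m\leq n$, \[\frac{n f_k(m,n)}{f_k(n)}=\varphi_k\left(\frac{m}{n}\right)\left(1+O_k\left(n^{-0.49}\right)\right),\] where \[\varphi_k(x)=\frac{1}{r_k}\left(1-\frac{(x/r_k)^{k-1}}{(k-1)!}+\frac{(x/r_k)^k}{k!}-\frac{(x/r_k)^{2k-1}}{(2k-1)!}+\frac{(x/r_k)^{2k}}{(2k)!}-\cdots\right).\]
   Context: For $w\in S_n$, a $k$-descent of $w$ starts at index $i$ (with $1\le i\le n-k+1$) if $w(i)>w(i+1)>\cdots>w(i+k-1)$. $f_k(n)$ is the number of $w\in S_n$ with no $k$-descent, and $f_k(m,n)$ is the number of such $w$ with $w(1)=m$. The constant $r_k>0$ is the one in the known theorem of Ehrenborg, Kitaev and Perry: for each $k\ge2$ there are real $c_k>0$, $r_k>0$, $0\le\gamma_k<1$ with $f_k(n)=n!\,c_k\,r_k^n(1+O_k(\gamma_k^n))$ (this determines $r_k$ uniquely). $O_k(g(n))$ denotes a quantity bounded in absolute value by $K g(n)$ for all sufficiently large $n$, where $K$ (and the threshold) depends only on $k$; in particular the bound is uniform in $m$. *)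

(* Defs.v *)
From HB Require Import structures.
From mathcomp Require Import all_boot all_order all_algebra all_fingroup.
From mathcomp Require Import all_classical all_reals all_analysis.
Set Implicit Arguments.
Unset Strict Implicit.
Unset Printing Implicit Defensive.
Import Order.TTheory GRing.Theory Num.Theory.
Import numFieldNormedType.Exports.
Local Open Scope ring_scope.

(** Permutations of {1, ..., n} are encoded as [w : 'S_n], i.e. as permutations
    of {0, ..., n-1}: both positions and values are shifted down by one.  Thus
    the condition 1 <= i <= n-k+1 on the start of a k-descent reads
    [i + k <= n]. *)
Definition descent_at (k n : nat) (w : 'S_n) (i : nat) : bool :=
  (i + k <= n)%N &&
  [forall a : 'I_n, forall b : 'I_n,
     [&& (i <= a)%N, b == a.+1 :> nat & (b < i + k)%N] ==> (w b < w a)%N].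

Definition no_descent (k n : nat) (w : 'S_n) : bool :=
  ~~ [exists i : 'I_n, descent_at k w i].

Definition f (k n : nat) : nat := #|[set w : 'S_n | no_descent k w]|.

(** [f_first k m n] is f_k(m,n); the value [m] is the usual 1-based one. *)
Definition f_first (k m n : nat) : nat :=
  #|[set w : 'S_n | no_descent k w &
       [exists i : 'I_n, (i == 0%N :> nat) && ((w i).+1 == m)]]|.

(** [r] is the growth rate r_k of the Ehrenborg-Kitaev-Perry asymptotics
    f_k(n) = n! c r^n (1 + O(gamma^n)); at most one [r] has this property. *)
Definition is_growth_rate (R : realType) (k : nat) (r : R) : Prop :=
  0 < r /\
  exists c gamma : R, exists e : nat -> R,
    [/\ 0 < c,
        0 <= gamma < 1,
        forall n, (f k n)%:R = n`!%:R * c * r ^+ n * (1 + e n) &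
        exists (K : R) (N : nat),
          forall n, (N <= n)%N -> `|e n| <= K * gamma ^+ n].

(** The terms of the alternating series are grouped in pairs: the j-th pair
    has exponents kj (sign +) and kj + k - 1 (sign -). *)
Definition phi (R : realType) (k : nat) (r x : R) : R :=
  r^-1 * limn (series (fun j : nat =>
    (x / r) ^+ (k * j)%N / ((k * j)`!)%N%:R
    - (x / r) ^+ (k * j + k.-1)%N / ((k * j + k.-1)`!)%N%:R)).

(** [e m n = O(g n)], uniformly in 1 <= m <= n. *)
Definition uniformO (R : realType) (e : nat -> nat -> R) (g : nat -> R) : Prop :=
  exists (K : R) (N : nat), forall n m,
    (N <= n)%N -> (1 <= m <= n)%N -> `|e m n| <= K * g n.

(* Main.v *)
Require Import Defs.
From mathcomp Require Import all_boot all_order all_algebra all_fingroup.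
From mathcomp Require Import all_classical all_reals all_analysis.
From mathcomp Require Import zify ring lra.
Set Implicit Arguments.
Unset Strict Implicit.
Unset Printing Implicit Defensive.
Import Order.TTheory GRing.Theory Num.Theory.
Import numFieldNormedType.Exports.
Local Open Scope ring_scope.

(** Write A(n,i) for the number of k-descent-free permutations of
    {0, ..., n-1} that start with i, so that f_k(m,n) = A(n,m-1).

    The proof rests on an exact formula.  Deleting the first entry of a
    permutation and standardizing the rest turns the counts Q_d(n,i) of those
    that moreover begin with a d-descent into
      A(n+1,i) = f_k(n) - sum_(j < i) Q_(d-1)(n,j) + Q_d(n+1,i),
    with Q_1 = A and Q_k = 0 ([f_run_rec]).  Let I be the operator
    (I h)(n+1,i) = sum_(j < i) h(n,j), and let E(n,i) = f_k(n-1).  Eliminating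
    the Q_d gives A = E - I^(k-1) E + I^k A, hence
    A = sum_l (I^(kl) E - I^(kl+k-1) E), a finite sum at each argument
    because I^p vanishes where i < p.  As I^p E (n,i) = C(i,p) f_k(n-1-p),
    this is [f_run1_expansion].

    The growth hypothesis makes n C(i,p) f_k(n-1-p) / f_k(n) equal to
    r^(-p-1) / p! times i(i-1)...(i-p+1) / ((n-1)...(n-p)), up to a factor
    close to 1, and that falling-factorial ratio is within p^2/n of (m/n)^p.
    The terms of the expansion thus match those of the series phi_k(m/n) with
    an error O(2^(-p)/n), and summing gives an additive error O(1/n)
    ([phi_approx]).

    To make the error relative, phi_k(m/n) has to stay away from 0.  A
    k-descent-free permutation that starts with an ascent stays k-descent-free
    whatever entry is put in front, as k >= 3.  Since no single first entry is
    too frequent, large first entries to put a smaller one in front of are not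
    rare, so there are many permutations with an initial ascent:
    f_k(n+1)^2 <= 2 f_k(n) A(n+3,i)
    ([f_sqr_le_f_run1]).  So n A(n,i) / f_k(n) >= 1/(12 r) for large n, and
    then phi_k(m/n) >= 1/(24 r) for large n.  Since phi_k depends on m/n only,
    replacing (m,n) by a large multiple (mq,nq) removes the restriction
    on n. *)

(** * Deleting the first entry of a permutation *)

(** Descents compare consecutive positions; reading a permutation as a function
    on all of nat, with the junk value 0 beyond n, avoids building ordinals for
    the successor positions. *)
Definition value_at (n : nat) (w : 'S_n) (a : nat) : nat :=
  oapp (fun o : 'I_n => w o : nat) 0%N (insub a).

Lemma value_atE n (w : 'S_n) (o : 'I_n) : value_at w o = w o.
Proof. by rewrite /value_at valK. Qed.

Lemma descent_atP k n (w : 'S_n) i :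
  reflect ((i + k <= n)%N /\ forall a, (i <= a)%N -> (a.+1 < i + k)%N ->
             (value_at w a.+1 < value_at w a)%N)
          (descent_at k w i).
Proof.
apply: (iffP andP) => -[le_n /= H]; split=> //.
  move=> a ia ak; have ltb : (a.+1 < n)%N by lia.
  have lta : (a < n)%N by lia.
  have := implyP (forallP (forallP H (Ordinal lta)) (Ordinal ltb)).
  rewrite -!value_atE /=; apply; apply/and3P; split=> //.
apply/forallP => a; apply/forallP => b; apply/implyP => /and3P[ia /eqP ab bk].
by rewrite -!value_atE ab; apply: H => //; rewrite -ab.
Qed.

Lemma value_at_lift_perm0 n (i : 'I_n.+1) (s : 'S_n) :
  value_at (lift_perm ord0 i s) 0 = i.
Proof. by rewrite -[0%N]/(nat_of_ord (ord0 : 'I_n.+1)) value_atE lift_perm_id. Qed.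

Lemma value_at_lift_permS n (i : 'I_n.+1) (s : 'S_n) a : (a < n)%N ->
  value_at (lift_perm ord0 i s) a.+1 = bump i (value_at s a).
Proof.
move=> an; have -> : a.+1 = lift ord0 (Ordinal an) by [].
by rewrite value_atE lift_perm_lift /= -value_atE.
Qed.

(** Putting i in front of s shifts the values of s by [bump i]; relative order,
    and comparison with i, are unaffected. *)
Lemma bump_ltn h x y : (bump h x < bump h y)%N = (x < y)%N.
Proof. rewrite /bump; lia. Qed.

Lemma bump_ltn_id h x : (bump h x < h)%N = (x < h)%N.
Proof. rewrite /bump; lia. Qed.

Lemma descent_at_lift_permS k n (i : 'I_n.+1) (s : 'S_n) j :
  descent_at k (lift_perm ord0 i s) j.+1 = descent_at k s j.
Proof.
apply/descent_atP/descent_atP => -[le_n H].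
  split=> [|a ja ak]; first lia.
  have := H a.+1; rewrite !value_at_lift_permS ?bump_ltn; [|lia|lia].
  by apply; lia.
split=> [|[|a] ja ak]; [lia|lia|].
by rewrite !value_at_lift_permS ?bump_ltn; [apply: H; lia|lia|lia].
Qed.

(** Prefixing i lengthens an initial descending run exactly when i exceeds the
    old first entry, that is, when the old first entry is < i before the
    shift. *)
Lemma descent_at_lift_perm0 d n (i : 'I_n.+1) (s : 'S_n) : (0 < d)%N ->
  descent_at d.+1 (lift_perm ord0 i s) 0
    = descent_at d s 0 && (value_at s 0 < i)%N.
Proof.
move=> d0; apply/descent_atP/andP => [[le_n H]|[/descent_atP[le_n H] lt_i]].
  split; last first.
    have := H 0%N isT.
    rewrite value_at_lift_perm0 value_at_lift_permS ?bump_ltn_id; last lia.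
    by apply; lia.
  apply/descent_atP; split=> [|a _ ad]; first lia.
  have := H a.+1 isT; rewrite !value_at_lift_permS ?bump_ltn; [|lia|lia].
  by apply; lia.
split=> [|[|a] _ ad]; first lia.
  by rewrite value_at_lift_perm0 value_at_lift_permS ?bump_ltn_id; lia.
by rewrite !value_at_lift_permS ?bump_ltn; [apply: H; lia|lia|lia].
Qed.

Lemma no_descentP k n (w : 'S_n) : (0 < k)%N ->
  reflect (forall i, ~~ descent_at k w i) (no_descent k w).
Proof.
move=> k0; apply: (iffP idP) => [|H]; last first.
  by apply/negP => /existsP[i]; apply/negP.
rewrite /no_descent negb_exists => /forallP H i; apply/negP => Di.
have /descent_atP[le_n _] := Di; have i_n : (i < n)%N by lia.
by have := H (Ordinal i_n); rewrite Di.
Qed.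

Lemma no_descent_lift_perm k n (i : 'I_n.+1) (s : 'S_n) : (0 < k)%N ->
  no_descent k (lift_perm ord0 i s)
    = no_descent k s && ~~ descent_at k (lift_perm ord0 i s) 0.
Proof.
move=> k0; apply/no_descentP/andP => // [H|[/no_descentP H H0]].
  split; last exact: H.
  by apply/no_descentP => // j; rewrite -(descent_at_lift_permS _ i).
by case=> [|j] //; rewrite descent_at_lift_permS H.
Qed.

(** Every permutation of n+1 points arises once by prefixing: the map is
    injective between sets of the same size (n+1)!. *)
Lemma lift_perm0_bij n :
  bijective (fun p : 'I_n.+1 * 'S_n => lift_perm ord0 p.1 p.2).
Proof.
apply: inj_card_bij; last by rewrite card_prod card_ord !card_Sn factS.
move=> [i s] [j t] /= E.
have ij : i = j by rewrite -(lift_perm_id ord0 i s) E lift_perm_id.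
rewrite -ij in E *; congr (_, _); apply/permP => a; apply: (@lift_inj _ i).
by rewrite -!(lift_perm_lift ord0) E.
Qed.

Lemma card_first_value n (i : 'I_n.+1) (P : pred 'S_n.+1) :
  #|[set w | P w & value_at w 0 == i]|
    = #|[set s : 'S_n | P (lift_perm ord0 i s)]|.
Proof.
have inj_i : injective (fun s : 'S_n => lift_perm ord0 i s).
  by move=> s t E; have [] := bij_inj (@lift_perm0_bij n) (E : _ (i, s) = _ (i, t)).
rewrite -(card_imset _ inj_i); apply: eq_card => w; rewrite inE.
apply/andP/imsetP => [[Pw /eqP wi]|[s]]; last first.
  by rewrite inE => Ps ->; rewrite value_at_lift_perm0.
have [g _ gK] := @lift_perm0_bij n; have := gK w; case: (g w) => j s /= E.
have ji : j = i by apply/val_inj; rewrite /= -wi -E value_at_lift_perm0.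
by exists s; rewrite ?inE -?ji E.
Qed.

Lemma card_lt_sum (T : finType) (P : pred T) (g : T -> nat) i :
  #|[set s | P s & (g s < i)%N]| = (\sum_(j < i) #|[set s | P s & g s == j]|)%N.
Proof.
elim: i => [|i IH].
  by rewrite big_ord0; apply/eqP; rewrite cards_eq0; apply/eqP/setP=> s; rewrite !inE andbF.
rewrite big_ord_recr -IH /= -(cardsID [set s | g s == i]) addnC.
by congr (_ + _)%N; apply: eq_card => s; rewrite !inE; case: (P s); rewrite //=; lia.
Qed.

(** * Counting by first entry and initial run *)

(** First values are 0-based here.  A 1-descent is just a position, so d = 1
    imposes no condition on the initial run; for d >= 1 the descent also
    forces n > 0, which keeps the junk of [value_at] out of the count. *)
Definition f_run (k d n i : nat) : nat :=
  #|[set w : 'S_n | no_descent k w && descent_at d w 0 & value_at w 0 == i]|.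

Lemma f_firstE k n i : f_first k i.+1 n = f_run k 1 n i.
Proof.
apply: eq_card => w; rewrite !inE; case: (no_descent k w) => //=.
apply/existsP/andP => [[p /andP[/eqP p0 /eqP[wp]]]|[/descent_atP[n0 _] /eqP wi]].
  split; last by rewrite -p0 value_atE wp.
  by apply/descent_atP; split=> [|a _]; [have := ltn_ord p|]; lia.
by exists (Ordinal n0); rewrite -value_atE /= wi eqxx.
Qed.

(** Let X be the set of k-descent-free s, and D_e the set of s for which
    prefixing i creates an initial e-descent.  The prefixed permutation is
    k-descent-free when s is in X minus D_k.  The left side is
    |X - D_k| + |X & D_(d+1)|, the right side |X| + |(X & D_(d+1)) - D_k|, and
    they agree because D_k is contained in D_(d+1). *)
Lemma f_run_rec k d n i : (0 < d < k)%N -> (i <= n)%N ->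
  (f_run k 1 n.+1 i + \sum_(j < i) f_run k d n j
     = f k n + f_run k d.+1 n.+1 i)%N.
Proof.
move=> /andP[d0 dk] i_n; have k0 : (0 < k)%N by lia.
pose o : 'I_n.+1 := Ordinal (i_n : (i < n.+1)%N).
rewrite /f_run !(card_first_value o) -card_lt_sum.
pose X := [set s : 'S_n | no_descent k s].
pose D e := [set s : 'S_n | descent_at e (lift_perm ord0 o s) 0].
(* An initial k-descent contains an initial (d+1)-descent, as d < k. *)
have subD : D k \subset D d.+1.
  apply/fintype.subsetP => s; rewrite !inE => /descent_atP[le_n H].
  by apply/descent_atP; split=> [|a a0 ad]; [|apply: H]; lia.
have -> : #|[set s : 'S_n | no_descent k (lift_perm ord0 o s) &
             descent_at 1 (lift_perm ord0 o s) 0]| = #|X :\: D k|.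
  apply: eq_card => s; rewrite !inE no_descent_lift_perm // [RHS]andbC.
  suff -> : descent_at 1 (lift_perm ord0 o s) 0 by rewrite andbT.
  by apply/descent_atP; split=> // a _; lia.
have -> : #|[set s : 'S_n | no_descent k (lift_perm ord0 o s) &
             descent_at d.+1 (lift_perm ord0 o s) 0]| = #|X :&: D d.+1 :\: D k|.
  apply: eq_card => s; rewrite !inE no_descent_lift_perm //.
  by rewrite -!andbA; do 2!bool_congr.
have -> : #|[set s : 'S_n | no_descent k s && descent_at d s 0 &
             (value_at s 0 < i)%N]| = #|X :&: D d.+1|.
  by apply: eq_card => s; rewrite !inE descent_at_lift_perm0 // andbA.
have -> : f k n = #|X| by [].
rewrite -(cardsID (D k) (X :&: D d.+1)) -(cardsID (D k) X).
rewrite -finset.setIA (finset.setIidPr subD).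
lia.
Qed.

Lemma f_run_full k n i : (0 < k)%N -> f_run k k n i = 0%N.
Proof.
move=> k0; apply/eqP; rewrite cards_eq0; apply/eqP/setP => w; rewrite !inE.
by apply/negP => /andP[/andP[/no_descentP/(_ 0%N)/negP H Dw] _]; apply: H.
Qed.

Lemma f_run_anti k d e n i : (d <= e)%N -> (f_run k e n i <= f_run k d n i)%N.
Proof.
move=> de; apply: subset_leq_card; apply/fintype.subsetP => w.
rewrite !inE => /andP[/andP[-> /descent_atP[le_n H]] ->] /=.
rewrite andbT; apply/descent_atP; split=> [|a a0 ad]; [|apply: H]; lia.
Qed.

Lemma sum_f_run1 k n : (0 < n)%N -> (\sum_(i < n) f_run k 1 n i = f k n)%N.
Proof.
move=> n0; rewrite -card_lt_sum; apply: eq_card => w; rewrite !inE.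
case: (no_descent k w) => //=; apply/andP; split.
  by apply/descent_atP; split=> // a _; lia.
by rewrite (value_atE w (Ordinal n0)).
Qed.

Lemma f_run1_rec k n i : (1 < k)%N -> (i <= n)%N ->
  (f_run k 1 n.+1 i + \sum_(j < i) f_run k k.-1 n j = f k n)%N.
Proof.
move=> k1 i_n; have := @f_run_rec k k.-1 n i.
by rewrite prednK ?f_run_full ?addn0 => [->||]; lia.
Qed.

(** * The exact expansion *)

(** The operator on arrays h(n,i) that corresponds to prefixing a larger
    entry: it turns counts by first entry for n into counts for n+1. *)
Definition prefix_sum (R : nmodType) (h : nat -> nat -> R) (n i : nat) : R :=
  if n is n'.+1 then \sum_(j < i) h n' j else 0.

Lemma iter_prefix_sum_eq0 (R : nmodType) (h : nat -> nat -> R) p n i :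
  (i < p)%N -> iter p (@prefix_sum R) h n i = 0.
Proof.
elim: p n i => // p IH [|n] i ip //=.
by rewrite big1 // => j _; apply: IH; have := ltn_ord j; lia.
Qed.

(** Stated for an array that splits only on the triangle i < n, which is where
    the identities between counts hold; [prefix_sum] preserves that
    triangle. *)
Lemma iter_prefix_sum_lin (R : zmodType) (h h1 h2 h3 : nat -> nat -> R) :
  (forall n i, (i < n)%N -> h n i = h1 n i - h2 n i + h3 n i) ->
  forall p n i, (i < n)%N ->
    iter p (@prefix_sum R) h n i
      = iter p (@prefix_sum R) h1 n i - iter p (@prefix_sum R) h2 n i
        + iter p (@prefix_sum R) h3 n i.
Proof.
move=> E; elim=> [|p IH] [|n] i i_n //; first exact: E.
rewrite /= -sumrB -big_split /=; apply: eq_bigr => j _.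
by apply: IH; have := ltn_ord j; lia.
Qed.

Lemma sum_bin_ord i p : (\sum_(j < i) 'C(j, p) = 'C(i, p.+1))%N.
Proof. by elim: i => [|i IH]; rewrite ?big_ord0 // big_ord_recr /= IH binS addnC. Qed.

Lemma iter_prefix_sum_bin (R : pzSemiRingType) (g : nat -> R) p n i : (i < n)%N ->
  iter p (@prefix_sum R) (fun m _ => g m.-1) n i = 'C(i, p)%:R * g (n.-1 - p)%N.
Proof.
elim: p n i => [|p IH] [|n] i i_n //; first by rewrite bin0 mul1r subn0.
rewrite /= -sum_bin_ord natr_sum mulr_suml; apply: eq_bigr => j _.
by rewrite IH; [congr (_ * g _)|have := ltn_ord j]; lia.
Qed.

(** Iterating the recurrence Q_(d+1) = A - E + I Q_d gives
    Q_(d+1) = (1 + I + ... + I^(d-1)) (A - E) + I^d A.  Applying 1 - I makes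
    the geometric sum telescope, which is the form proved here by induction. *)
Lemma f_run_resolvent (R : comNzRingType) k d n i : (d < k)%N -> (i < n)%N ->
  let q e := fun n i => (f_run k e n i)%:R : R in
  let e0 := fun n (_ : nat) => (f k n.-1)%:R : R in
  q d.+1 n i - prefix_sum (q d.+1) n i
    = q 1 n i - e0 n i + iter d (@prefix_sum R) e0 n i
      - iter d.+1 (@prefix_sum R) (q 1) n i.
Proof.
move=> dk i_n q e0; elim: d n i dk i_n => [|d IH] [|n] i dk i_n //=.
  by rewrite subrK.
have qrec m j : (j < m)%N -> q d.+2 m j = q 1 m j - e0 m j + prefix_sum (q d.+1) m j.
  case: m => // m jm; rewrite /q /e0 /= -natr_sum.
  have /(congr1 (fun x => x%:R : R)) := @f_run_rec k d.+1 m j dk jm.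
  by rewrite !natrD => E; apply: (addrI (f k m)%:R); rewrite -E; ring.
rewrite qrec // /= -addrA -[RHS]addrA -!sumrB; congr (_ + _).
 apply: eq_bigr => j _.
have jn : (j < n)%N by have := ltn_ord j; lia.
have := IH n j (ltnW dk) jn; rewrite qrec //= => E.
by rewrite opprD [- _ - _]addrC addrA E; ring.
Qed.

Lemma f_run1_eq_iter (R : comNzRingType) k n i : (0 < k)%N -> (i < n)%N ->
  let a := fun n i => (f_run k 1 n i)%:R : R in
  let e0 := fun n (_ : nat) => (f k n.-1)%:R : R in
  a n i = e0 n i - iter k.-1 (@prefix_sum R) e0 n i + iter k (@prefix_sum R) a n i.
Proof.
move=> k0 i_n a e0; have := @f_run_resolvent R k k.-1 n i; rewrite prednK //.
move=> /(_ (leqnn k) i_n) /=; rewrite f_run_full // sub0r.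
have -> : prefix_sum (fun n i => (f_run k k n i)%:R : R) n i = 0.
  by case: (n) => //= n'; rewrite big1 // => j _; rewrite f_run_full.
rewrite oppr0 => /eqP; rewrite eq_sym subr_eq0 => /eqP <-.
by rewrite /a /e0; ring.
Qed.

(** The fixed-point equation A = E - I^(k-1) E + I^k A unrolled L times; the
    remainder I^(kL) A vanishes at (n,i) as soon as kL > i. *)
Lemma f_run1_expansion (R : comNzRingType) k n i L :
  (0 < k)%N -> (i < n)%N -> (n <= L)%N ->
  (f_run k 1 n i)%:R =
    \sum_(l < L) ('C(i, k * l)%:R * (f k (n.-1 - k * l))%:R
      - 'C(i, k * l + k.-1)%:R * (f k (n.-1 - (k * l + k.-1)))%:R) :> R.
Proof.
move=> k0 i_n n_L; pose a n i : R := (f_run k 1 n i)%:R.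
pose e0 n (_ : nat) : R := (f k n.-1)%:R.
suff E : a n i = \sum_(l < L) (iter (k * l) (@prefix_sum R) e0 n i
    - iter (k * l + k.-1) (@prefix_sum R) e0 n i) + iter (k * L) (@prefix_sum R) a n i.
  rewrite -/(a n i) E iter_prefix_sum_eq0 ?addr0; last by nia.
  apply: eq_bigr => l _.
  by rewrite !(@iter_prefix_sum_bin _ (fun m => (f k m)%:R)).
elim: L {n_L} => [|L IH]; first by rewrite big_ord0 muln0 add0r.
rewrite IH big_ord_recr -addrA /=; congr (_ + _).
have /iter_prefix_sum_lin-> // : forall n i, (i < n)%N -> a n i
    = e0 n i - iter k.-1 (@prefix_sum R) e0 n i + iter k (@prefix_sum R) a n i.
  by move=> m j jm; apply: f_run1_eq_iter.
by rewrite -!iterD mulnSr.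
Qed.

Lemma f_run1_le k n i : (1 < k)%N -> (i <= n)%N -> (f_run k 1 n.+1 i <= f k n)%N.
Proof. by move=> k1 i_n; rewrite -(f_run1_rec k1 i_n) leq_addr. Qed.

(** * A lower bound uniform in the first entry *)

(** Each a_l occurs in the inner sums for j = l+1, ..., n, hence n - l times,
    and l + 1 more times in the weighted sum. *)
Lemma sum_prefix_weighted (a : nat -> nat) n :
  (\sum_(j < n.+1) \sum_(l < j) a l + \sum_(l < n) l.+1 * a l
     = n.+1 * \sum_(l < n) a l)%N.
Proof.
elim: n => [|n IH]; first by rewrite big_ord_recl !big_ord0.
rewrite [X in (X + _)%N]big_ord_recr [X in (_ + X)%N = _]big_ord_recr addnACA IH.
rewrite !big_ord_recr /=; lia.
Qed.

(** For k >= 3 a k-descent-free permutation of n+1 entries with an ascent at its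
    start remains k-descent-free after prefixing any i.  Those permutations
    come from prefixing some j' <= j to one of n entries with first entry j,
    whence the weight j + 1. *)
Lemma weighted_sum_le_f_run1 k n i : (2 < k)%N -> (0 < n)%N -> (i <= n.+1)%N ->
  (\sum_(j < n) j.+1 * f_run k 1 n j <= f_run k 1 n.+2 i)%N.
Proof.
move=> k2 n0 i_n; have k1 : (1 < k)%N by lia.
have rec1 := f_run1_rec k1 i_n.
have le_q : (\sum_(j < i) f_run k k.-1 n.+1 j <= \sum_(j < n.+1) f_run k 2 n.+1 j)%N.
  rewrite -!(big_mkord xpredT (fun j => f_run k _ n.+1 j)).
  rewrite (big_cat_nat (n := i) (p := n.+1)) //=; apply: leq_trans (leq_addr _ _).
  by apply: leq_sum => j _; apply: f_run_anti; lia.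
have E : (\sum_(j < n.+1) (f_run k 1 n.+1 j + \sum_(l < j) f_run k 1 n l)
    = \sum_(j < n.+1) (f k n + f_run k 2 n.+1 j))%N.
  by apply: eq_bigr => j _; apply: f_run_rec; [lia|have := ltn_ord j; lia].
have := sum_prefix_weighted (f_run k 1 n) n; move: E rec1 le_q.
rewrite !big_split /= sum_nat_const card_ord !sum_f_run1 //; lia.
Qed.

(** With each a_j at most M, a total mass S cannot be packed below position S/M,
    so its first moment is at least about S^2/(2M). *)
Lemma sqr_sum_le_weighted (a : nat -> nat) M n : (forall j, (j < n)%N -> a j <= M)%N ->
  ((\sum_(j < n) a j) ^ 2 <= 2 * M * \sum_(j < n) j.+1 * a j)%N.
Proof.
elim: n => [|n IH] aM; first by rewrite !big_ord0.
have {}IH := IH (fun j jn => aM j (ltnW jn)).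
have anM := aM n (leqnn _).
have SM : (\sum_(j < n) a j <= n * M)%N.
  rewrite -[in leqRHS](card_ord n) -sum_nat_const; apply: leq_sum => j _.
  by apply: aM; have := ltn_ord j; lia.
rewrite !big_ord_recr /=; move: IH SM.
move: (\sum_(j < n) a j)%N (\sum_(j < n) _ * _)%N => S W IH SM.
have := leq_mul SM (leqnn (a n)); have := leq_mul anM (leqnn (a n)).
move: IH; rewrite -!mulnn; nia.
Qed.

Lemma f_sqr_le_f_run1 k n i : (2 < k)%N -> (i < n.+3)%N ->
  (f k n.+1 ^ 2 <= 2 * f k n * f_run k 1 n.+3 i)%N.
Proof.
move=> k2 i_n; rewrite -sum_f_run1 //.
have W := @weighted_sum_le_f_run1 k n.+1 i k2 isT i_n.
apply: (leq_trans _ (leq_mul (leqnn (2 * f k n)) W)).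
by apply: sqr_sum_le_weighted => j jn; apply: f_run1_le; lia.
Qed.

(** * The growth hypothesis *)

(** The geometric error is weakened to K/(n+1), now for every n: terms of the
    expansion involve f_k at small arguments, where an estimate valid only for
    large n says nothing. *)
Definition uniform_growth (R : realType) k (r c K : R) (e : nat -> R) : Prop :=
  [/\ 0 < r, 0 < c,
      forall n, (f k n)%:R = n`!%:R * c * r ^+ n * (1 + e n) &
      forall n, `|e n| <= K / n.+1%:R].

Lemma sum_geometric_le (R : realType) (g : R) n : 0 <= g < 1 ->
  \sum_(i < n) g ^+ i <= (1 - g)^-1.
Proof.
move=> /andP[g0 g1]; have g1' : 0 < 1 - g by rewrite subr_gt0.
have sumE : (1 - g) * \sum_(i < n) g ^+ i = 1 - g ^+ n.
  by rewrite -opprB -[RHS]opprB subrX1 mulNr.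
by rewrite -[leRHS]mul1r ler_pdivlMr // mulrC sumE gerBl exprn_ge0.
Qed.

(** Each of the n+1 summands of 1 + g + ... + g^n is at least g^n. *)
Lemma geometric_le_inv (R : realType) (g : R) n : 0 <= g < 1 ->
  n.+1%:R * g ^+ n <= (1 - g)^-1.
Proof.
move=> g01; apply: le_trans (sum_geometric_le n.+1 g01); case/andP: g01 => g0 g1.
rewrite mulr_natl -[in leLHS](card_ord n.+1) -sumr_const.
by apply: ler_sum => i _; apply: ler_wiXn2l; rewrite // ?ltW // -ltnS.
Qed.

Lemma growth_rate_uniform (R : realType) k (r : R) :
  is_growth_rate k r -> exists c K e, 0 <= K /\ uniform_growth k r c K e.
Proof.
move=> [r0 [c [g [e [c0 g01 fE [K [N eK]]]]]]].
have g1 : 0 < 1 - g by rewrite subr_gt0; case/andP: g01.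
pose K' := `|K| / (1 - g) + \sum_(i < N) i.+1%:R * `|e i|.
have S0 : 0 <= \sum_(i < N) i.+1%:R * `|e i| by apply: sumr_ge0 => i _; rewrite mulr_ge0.
have K0 : 0 <= `|K| / (1 - g) by rewrite divr_ge0 // ltW.
exists c, K', e; split; first by rewrite /K' addr_ge0.
split=> // n; rewrite ler_pdivlMr ?ltr0Sn // mulrC.
have [Nn|nN] := leqP N n.
  apply: (@le_trans _ _ (`|K| / (1 - g))); last by rewrite lerDl.
  apply: le_trans (ler_wpM2l (normr_ge0 K) (geometric_le_inv n g01)).
  rewrite mulrCA ler_wpM2l //; apply: le_trans (eK n Nn) _.
  by rewrite ler_wpM2r ?ler_norm // exprn_ge0; case/andP: g01.
rewrite /K' (bigD1 (Ordinal nN)) //= addrCA lerDl addr_ge0 //.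
by apply: sumr_ge0 => i _; rewrite mulr_ge0.
Qed.

(** (2z)^p / p! is a single term of the exponential series of 2z. *)
Lemma exp_term_le (R : realType) (z : R) p : 0 <= z ->
  z ^+ p / p`!%:R <= expR (2 * z) * 2^-1 ^+ p.
Proof.
move=> z0; rewrite exprVn ler_pdivlMr ?exprn_gt0 //.
rewrite mulrAC -exprMn mulrC mulrC [z * 2]mulrC.
case: p => [|p]; first by rewrite expr0 fact0 divr1 -expR0 ler_expR mulr_ge0.
by apply: le_trans (expR_ge1Dxn p _); rewrite ?lerDr ?mulr_ge0.
Qed.

Lemma mediant_sub (F : fieldType) (a b d : F) : d != 0 -> d + b != 0 ->
  (a + b) / (d + b) - a / d = b / (d + b) * ((d - a) / d).
Proof. by move=> d0 db0; field; rewrite d0 db0. Qed.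

(** * Comparison with the series term by term *)

(** The product of (i-a)/(n-1-a) over a < p; it is 0 for p > i. *)
Definition ffact_ratio (R : realType) (n i p : nat) : R :=
  (i ^_ p)%:R / (n.-1 ^_ p)%:R.

(** With m = i+1, the p-th factor (m-(p+1))/(n-(p+1)) differs from m/n by at
    most (p+1)/n, and all factors lie in [0,1], so the errors add up to at
    most p^2/n.  For p > i the ratio is 0 and (m/n)^p <= m/n <= p/n. *)
Lemma ffact_ratio_approx (R : realType) n i p : (i < n)%N ->
  0 <= ffact_ratio R n i p <= 1
  /\ `|(i.+1%:R / n%:R) ^+ p - ffact_ratio R n i p| <= p%:R ^+ 2 / n%:R.
Proof.
move=> i_n; have n0 : 0 < n%:R :> R by rewrite ltr0n; lia.
have n0' := ltW n0.
pose x : R := i.+1%:R / n%:R; rewrite -/x.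
have x01 : 0 <= x <= 1 by rewrite divr_ge0 //= ler_pdivrMr // mul1r ler_nat.
have [x0 x1] := andP x01.
elim: p => [|p [/andP[r0 r1] IH]].
  by rewrite /ffact_ratio !ffactn0 divr1 !expr0 subrr normr0 lexx ler01 divr_ge0.
have [p_i|i_p] := leqP p i; last first.
  rewrite {1 2}/ffact_ratio ffact_small ?mul0r ?subr0; last lia.
  rewrite lexx ler01; split=> //; rewrite /ffact_ratio ffact_small ?mul0r ?subr0; last lia.
  rewrite ger0_norm ?exprn_ge0 // exprS.
  apply: (@le_trans _ _ x); first by rewrite -[leRHS]mulr1 ler_wpM2l // exprn_ile1.
  by rewrite /x ler_wpM2r ?invr_ge0 // -natrX ler_nat; nia.
pose q : R := (i - p)%:R / (n.-1 - p)%:R.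
have rS : ffact_ratio R n i p.+1 = ffact_ratio R n i p * q.
  by rewrite /ffact_ratio /q !ffactnSr !natrM invfM mulrACA.
have q01 : 0 <= q <= 1.
  rewrite /q divr_ge0 //=; have [->|np] := posnP (n.-1 - p)%N.
    by rewrite invr0 mulr0 ler01.
  by rewrite ler_pdivrMr ?ltr0n // mul1r ler_nat; lia.
have [q0 q1] := andP q01.
have xq : `|x - q| <= p.+1%:R / n%:R.
  (* At p = i < n the factor q is 0, whatever its denominator, which may be 0. *)
  have [p_eq|p_lt] := eqVneq p i.
    by rewrite /q /x p_eq subnn mul0r subr0 ger0_norm.
  have d0 : 0 < (n.-1 - p)%:R :> R.
    by rewrite ltr0n; move: i_n p_i p_lt; clear; lia.
  have nE : n%:R = (n.-1 - p)%:R + p.+1%:R :> R.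
    by rewrite -natrD; congr _%:R; move: i_n p_i; clear; lia.
  have iE : i.+1%:R = (i - p)%:R + p.+1%:R :> R.
    by rewrite -natrD; congr _%:R; move: p_i; clear; lia.
  have le_d : (i - p)%:R <= (n.-1 - p)%:R :> R by rewrite ler_nat; move: i_n; clear; lia.
  have -> : x - q
      = p.+1%:R / n%:R * (((n.-1 - p)%:R - (i - p)%:R) / (n.-1 - p)%:R).
    by rewrite /x /q iE nE mediant_sub -?nE ?gt_eqF.
  rewrite normrM ger0_norm ?divr_ge0 // -[leRHS]mulr1 ler_wpM2l ?divr_ge0 //.
  rewrite ger0_norm ?divr_ge0 ?subr_ge0 //.
  by rewrite ler_pdivrMr // mul1r gerBl.
rewrite rS mulr_ge0 //= mulr_ile1 //; split=> //.
have prod_diff (a b c d : R) : a * b - c * d = a * (b - c) + c * (a - d) by ring.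
rewrite exprS prod_diff; apply: le_trans (ler_normD _ _) _; 
rewrite (normrM x) (normrM (ffact_ratio _ _ _ _)) (ger0_norm x0) (ger0_norm r0).
apply: (@le_trans _ _ (p%:R ^+ 2 / n%:R + p.+1%:R / n%:R)).
  by apply: lerD; rewrite -[leRHS]mul1r; apply: ler_pM.
rewrite -mulrDl ler_wpM2r ?invr_ge0 // -!natrX -natrD ler_nat; clear; nia.
Qed.

(** n! = n ((n-1)...(n-p)) (n-1-p)! isolates the falling-factorial ratio; the
    constant c and the powers of r cancel down to r^(-p-1). *)
Lemma first_value_term_eq (R : realType) k (r c K : R) (e : nat -> R) n i p :
  uniform_growth k r c K e -> (i < n)%N -> 1 + e n != 0 ->
  n%:R * ('C(i, p)%:R * (f k (n.-1 - p))%:R) / (f k n)%:R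
    = r^-1 * (r^-1 ^+ p / p`!%:R)
      * (ffact_ratio R n i p * ((1 + e (n.-1 - p)%N) / (1 + e n))).
Proof.
move=> [r0 c0 fE _] i_n en0.
have [p_i|i_p] := leqP p i; last first.
  by rewrite /ffact_ratio bin_small // ffact_small // !(mul0r, mulr0).
have nfact : n`!%:R = n%:R * (n.-1 ^_ p)%:R * (n.-1 - p)`!%:R :> R.
  rewrite -!natrM; congr _%:R; case: n i_n {en0} => // n i_n.
  by rewrite factS -(@ffact_fact n p) ?mulnA //; lia.
have npow : r ^+ n = r ^+ (n.-1 - p) * r ^+ p * r.
  by rewrite -exprD -exprSr; congr (_ ^+ _); move: i_n p_i; clear; lia.
rewrite !fE nfact npow /ffact_ratio -(bin_ffact i) natrM exprVn.
have alg (N B G Rg E' E M P Rp : R) :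
    N != 0 -> G != 0 -> Rg != 0 -> E != 0 -> M != 0 -> P != 0 -> Rp != 0 ->
  N * (B * (G * c * Rg * E')) / (N * M * G * c * (Rg * Rp * r) * E)
  = r^-1 * (Rp^-1 / P) * (B * P / M * (E' / E)).
  move=> *; field; rewrite !(gt_eqF r0) !(gt_eqF c0) /=; do ?[apply/andP; split=> //].
have r_neq0 : r != 0 by rewrite gt_eqF.
apply: alg; rewrite ?expf_neq0 // pnatr_eq0 -lt0n ?fact_gt0 //; first lia.
by rewrite ffact_gt0; lia.
Qed.

(** The error bound K/(n-p) at the shifted argument n-1-p is still O(1/n), at
    the price of a factor p+1: (p+1)(n-p) >= n. *)
Lemma inv_sub_le (R : realType) n p : (p < n)%N ->
  (n.-1 - p).+1%:R^-1 <= p.+1%:R / n%:R :> R.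
Proof.
move=> p_n; rewrite ler_pdivlMr ?ltr0n; last by lia.
rewrite mulrC ler_pdivrMr ?ltr0n // -natrM ler_nat; nia.
Qed.

Lemma first_value_term_approx (R : realType) k (r c K : R) (e : nat -> R) n i p :
  uniform_growth k r c K e -> 0 <= K -> (i < n)%N -> `|e n| <= 2^-1 ->
  `|n%:R * ('C(i, p)%:R * (f k (n.-1 - p))%:R) / (f k n)%:R
    - r^-1 * ((i.+1%:R / n%:R / r) ^+ p / p`!%:R)|
  <= r^-1 * (r^-1 ^+ p / p`!%:R) * ((4 * K + 1) * (p.+1%:R ^+ 2 / n%:R)).
Proof.
move=> sg K0 i_n en; have [r0 c0 fE eK] := sg.
have n0 : 0 < n%:R :> R by rewrite ltr0n; lia.
have n0' := ltW n0.
have E12 : 2^-1 <= 1 + e n by move: en; rewrite ler_norml => /andP[]; lra.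
have E0 : 0 < 1 + e n by lra.
rewrite (first_value_term_eq p sg i_n) ?gt_eqF // exprMn.
have [/andP[rho0 rho1] rho_x] := ffact_ratio_approx R p i_n.
move: rho0 rho1 rho_x.
set rho := ffact_ratio _ _ _ _; set x := i.+1%:R / n%:R; set g := _ / (1 + e n).
move=> rho0 rho1 rho_x.
rewrite -mulrA [x ^+ p * _ / _]mulrAC.
have -> : r^-1 * (r^-1 ^+ p / p`!%:R * (rho * g)) - r^-1 * (x ^+ p / p`!%:R * r^-1 ^+ p)
  = r^-1 * (r^-1 ^+ p / p`!%:R) * (rho * g - x ^+ p).
  by move: (x ^+ p) (r^-1 ^+ p) (p`!%:R^-1) => *; ring.
rewrite normrM ger0_norm; last by rewrite mulr_ge0 ?divr_ge0 ?exprn_ge0 ?invr_ge0 // ltW.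
rewrite ler_wpM2l //.
  by rewrite mulr_ge0 ?divr_ge0 ?exprn_ge0 ?invr_ge0 // ltW.
have p2 : p%:R ^+ 2 / n%:R <= p.+1%:R ^+ 2 / n%:R :> R.
  by rewrite ler_wpM2r ?invr_ge0 // -!natrX ler_nat leq_exp2r.
have [p_i|i_p] := leqP p i; last first.
  rewrite /rho /ffact_ratio ffact_small // !mul0r sub0r normrN.
  move: rho_x; rewrite /rho /ffact_ratio ffact_small // !mul0r subr0.
  move=> rho_x; apply: le_trans rho_x _; apply: le_trans p2 _.
  by rewrite mulrDl mul1r lerDr !mulr_ge0 ?invr_ge0 ?exprn_ge0.
have -> : rho * g - x ^+ p = rho * (g - 1) - (x ^+ p - rho).
  by move: (x ^+ p) => X; ring.
apply: le_trans (ler_normB _ _) _; rewrite normrM (ger0_norm rho0).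
have p1_le : p.+1%:R / n%:R <= p.+1%:R ^+ 2 / n%:R :> R.
  by rewrite ler_wpM2r ?invr_ge0 // -natrX ler_nat leq_pmulr.
have p_n := leq_ltn_trans p_i i_n.
have e1 : `|e (n.-1 - p)%N| <= K * (p.+1%:R ^+ 2 / n%:R).
  apply: le_trans (eK _) _; rewrite ler_wpM2l //.
  by apply: le_trans (inv_sub_le R p_n) _.
have e2 : `|e n| <= K * (p.+1%:R ^+ 2 / n%:R).
  apply: le_trans (eK _) _; rewrite ler_wpM2l //; apply: le_trans p1_le.
  apply: (@le_trans _ _ n%:R^-1); first by rewrite lef_pV2 ?posrE ?ler_nat.
  by rewrite ler_peMl ?invr_ge0 // ler1n.
have g1 : `|g - 1| <= 4 * K * (p.+1%:R ^+ 2 / n%:R).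
  have -> : g - 1 = (e (n.-1 - p)%N - e n) / (1 + e n).
    by rewrite /g; field; rewrite gt_eqF.
  rewrite normrM normfV (gtr0_norm E0) ler_pdivrMr //.
  apply: le_trans (ler_normB _ _) _; apply: le_trans (lerD e1 e2) _.
  rewrite -mulrA; set T := K * _.
  have T0 : 0 <= T := le_trans (normr_ge0 _) e2.
  apply: (@le_trans _ _ (4 * T * 2^-1)); first by clear -T0; lra.
  by rewrite ler_wpM2l // mulr_ge0.
rewrite [leRHS]mulrDl mul1r; apply: lerD; last exact: le_trans p2.
by apply: le_trans g1; rewrite ler_piMl.
Qed.

(** The quadratic factor (p+1)^2 <= 4^p is absorbed into the powers of 1/r, and
    then (4/r)^p / p! <= exp(8/r) 2^(-p). *)
Definition first_value_const (R : realType) (r K : R) : R :=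
  (4 * K + 1) * (r^-1 * expR (2 * (4 * r^-1))).

Lemma first_value_term_geometric (R : realType) k (r c K : R) (e : nat -> R) n i p :
  uniform_growth k r c K e -> 0 <= K -> (i < n)%N -> `|e n| <= 2^-1 ->
  `|n%:R * ('C(i, p)%:R * (f k (n.-1 - p))%:R) / (f k n)%:R
    - r^-1 * ((i.+1%:R / n%:R / r) ^+ p / p`!%:R)|
  <= first_value_const r K / n%:R * 2^-1 ^+ p.
Proof.
move=> sg K0 i_n en; apply: le_trans (first_value_term_approx p sg K0 i_n en) _.
have [r0 _ _ _] := sg; have y0 : 0 <= r^-1 by rewrite invr_ge0 ltW.
have four : p.+1%:R ^+ 2 <= 4 ^+ p :> R.
  by rewrite -!natrX ler_nat (_ : 4 = 2 ^ 2)%N // expnAC leq_exp2r // ltn_expl.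
have expo := @exp_term_le R (4 * r^-1) p (mulr_ge0 (ler0n _ _) y0).
rewrite /first_value_const.
have -> : r^-1 * (r^-1 ^+ p / p`!%:R) * ((4 * K + 1) * (p.+1%:R ^+ 2 / n%:R))
  = (4 * K + 1) * r^-1 / n%:R * (p.+1%:R ^+ 2 * r^-1 ^+ p / p`!%:R).
  by move: (r^-1 ^+ p) (p`!%:R^-1) (n%:R^-1) (p.+1%:R) => *; ring.
have -> : (4 * K + 1) * (r^-1 * expR (2 * (4 * r^-1))) / n%:R * 2^-1 ^+ p
  = (4 * K + 1) * r^-1 / n%:R * (expR (2 * (4 * r^-1)) * 2^-1 ^+ p).
  by move: (2^-1 ^+ p) (n%:R^-1) (expR _) => *; ring.
rewrite ler_wpM2l //; first by rewrite !mulr_ge0 ?invr_ge0 ?addr_ge0 ?mulr_ge0 // ltW.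
apply: (le_trans _ expo); rewrite exprMn ler_wpM2r ?invr_ge0 // ler_wpM2r ?exprn_ge0 //.
Qed.

Lemma first_value_const_ge0 (R : realType) (r K : R) :
  0 < r -> 0 <= K -> 0 <= first_value_const r K.
Proof.
move=> r0 K0; rewrite /first_value_const.
by rewrite !mulr_ge0 ?expR_ge0 ?invr_ge0 ?addr_ge0 ?mulr_ge0 // ltW.
Qed.

(** * Summing the series *)
Definition phi_term (R : realType) k (z : R) (l : nat) : R :=
  z ^+ (k * l)%N / ((k * l)`!)%N%:R
  - z ^+ (k * l + k.-1)%N / ((k * l + k.-1)`!)%N%:R.

Lemma sum_two_progressions_le (R : realType) k L : (0 < k)%N ->
  \sum_(l < L) (2^-1 ^+ (k * l) + 2^-1 ^+ (k * l + k.-1)) <= 4 :> R.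
Proof.
move=> k0; have half : 0 <= (2^-1 : R) < 1 by lra.
have [h0 h1] := andP half.
apply: (@le_trans _ _ (\sum_(l < L) 2 * 2^-1 ^+ l)).
  apply: ler_sum => l _; rewrite mulr_natl mulr2n.
  by apply: lerD; apply: ler_wiXn2l; rewrite // ?ltW //; nia.
rewrite -mulr_sumr; apply: le_trans (ler_wpM2l _ (sum_geometric_le L half)) _ => //.
have -> : 1 - 2^-1 = 2^-1 :> R by lra.
by rewrite invrK; lra.
Qed.

Lemma cvg_series_phi_term (R : realType) k (z : R) : (0 < k)%N -> 0 <= z ->
  cvgn (series (phi_term k z)).
Proof.
move=> k0 z0; apply: normed_cvg.
have half : 0 <= (2^-1 : R) < 1 by lra.
have [h0 h1] := andP half.
have D0 : 0 <= expR (2 * z) * 2 by rewrite mulr_ge0 ?expR_ge0.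
apply: (@series_le_cvg _ _ (geometric (expR (2 * z) * 2) 2^-1)) => [l|l|l|].
- exact: normr_ge0.
- by rewrite /geometric /= mulr_ge0 ?exprn_ge0.
- apply: le_trans (ler_normB _ _) _; rewrite /geometric /=.
  rewrite -mulrA (mulr_natl (2^-1 ^+ l)) mulr2n mulrDr.
  apply: lerD; rewrite ger0_norm ?divr_ge0 ?exprn_ge0 //; apply: le_trans (exp_term_le _ z0) _.
    by rewrite ler_wpM2l ?expR_ge0 // ler_wiXn2l ?ltW //; nia.
  by rewrite ler_wpM2l ?expR_ge0 // ler_wiXn2l ?ltW //; nia.
- by apply: is_cvg_geometric_series; rewrite ger0_norm.
Qed.

(** The expansion holds for every truncation L >= n, so the termwise bounds sum
    to an estimate uniform in L, which passes to the limit. *)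
Lemma phi_approx (R : realType) k (r c K : R) (e : nat -> R) n i :
  (0 < k)%N -> uniform_growth k r c K e -> 0 <= K -> (i < n)%N -> `|e n| <= 2^-1 ->
  `|n%:R * (f_run k 1 n i)%:R / (f k n)%:R - phi k r (i.+1%:R / n%:R)|
    <= 4 * first_value_const r K / n%:R.
Proof.
move=> k0 sg K0 i_n en; have [r0 _ _ _] := sg.
set T := _ / (f k n)%:R; set z := i.+1%:R / n%:R / r; set B := first_value_const r K.
have z0 : 0 <= z by rewrite !divr_ge0 // ltW.
have B0 : 0 <= B := first_value_const_ge0 r0 K0.
have partial L : (n <= L)%N -> `|T - r^-1 * series (phi_term k z) L| <= 4 * B / n%:R.
  move=> n_L; rewrite /T (f_run1_expansion _ k0 i_n n_L) mulr_sumr mulr_suml.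
  rewrite /series /= big_mkord mulr_sumr -sumrB.
  apply: le_trans (ler_norm_sum _ _ _) _.
  apply: (@le_trans _ _ (\sum_(l < L)
      B / n%:R * (2^-1 ^+ (k * l) + 2^-1 ^+ (k * l + k.-1)))); last first.
    rewrite -mulr_sumr mulrC mulrA ler_wpM2r ?invr_ge0 // ler_wpM2r //.
    exact: sum_two_progressions_le.
  have regroup (N a b F y u v : R) :
      N * (a - b) * F - y * (u - v) = (N * a * F - y * u) - (N * b * F - y * v).
    by ring.
  apply: ler_sum => l _; rewrite /phi_term regroup; apply: le_trans (ler_normB _ _) _.
  by rewrite mulrDr; apply: lerD; apply: (first_value_term_geometric _ sg).
have cv := @cvg_series_phi_term _ k z k0 z0.
have -> : phi k r (i.+1%:R / n%:R) = r^-1 * limn (series (phi_term k z)) by [].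
have bounds L : (n <= L)%N -> r * (T - 4 * B / n%:R) <= series (phi_term k z) L
    /\ series (phi_term k z) L <= r * (T + 4 * B / n%:R).
  move=> /partial; move: (4 * B / n%:R) => D; rewrite ler_distlC => /andP[lo hi].
  split; first by rewrite mulrC -ler_pdivlMr // mulrC.
  by rewrite mulrC -ler_pdivrMr // mulrC.
rewrite ler_distlC [r^-1 * _]mulrC ler_pdivlMr // ler_pdivrMr // !(mulrC _ r).
apply/andP; split.
  apply: limr_ge => //; exists n => // L /= nL; exact: (bounds L nL).1.
apply: limr_le => //; exists n => // L /= nL; exact: (bounds L nL).2.
Qed.

(** Up to the factors 1 + e, the bound f_k(n+1)^2 / (2 f_k(n)) equals
    (n+1) H / 2 with H = (n+1) n! c r^(n+2), while f_k(n+3) / (n+3) is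
    (n+2) r H.  The quotient (n+1) / (2 (n+2) r) is at least 1/(4r), and
    errors of at most 1/4 cost less than a factor 3. *)
Lemma first_value_lower (R : realType) k (r c K : R) (e : nat -> R) n i :
  (2 < k)%N -> uniform_growth k r c K e -> (i < n.+3)%N ->
  `|e n| <= 4^-1 -> `|e n.+1| <= 4^-1 -> `|e n.+3| <= 4^-1 ->
  r^-1 / 12 <= n.+3%:R * (f_run k 1 n.+3 i)%:R / (f k n.+3)%:R.
Proof.
move=> k2 [r0 c0 fE _] i_n; rewrite !ler_norml => /andP[a0 a1] /andP[b0 b1] /andP[d0 d1].
have := f_sqr_le_f_run1 k2 i_n; rewrite -(ler_nat R) natrX !natrM !fE.
move: (f_run k 1 n.+3 i)%:R => a.
have -> : (n.+3)`!%:R = n.+3%:R * n.+2%:R * n.+1%:R * n`!%:R :> R.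
  by rewrite !factS !natrM !mulrA.
have -> : (n.+1)`!%:R = n.+1%:R * n`!%:R :> R by rewrite factS natrM.
have -> : r ^+ n.+3 = r ^+ 3 * r ^+ n by rewrite -exprD.
have -> : r ^+ n.+1 = r * r ^+ n by rewrite exprS.
have G0 : 0 < n`!%:R * c * r ^+ n.
  by rewrite !mulr_gt0 ?exprn_gt0 // ltr0n fact_gt0.
rewrite ler_pdivlMr; last first.
  rewrite !mulr_gt0 ?exprn_gt0 // ?ltr0n ?fact_gt0 //; lra.
(* Everything is now a multiple of G = n! c r^n; dividing by it leaves an
   inequality between polynomials in n, r and the three errors. *)
have n1 : n.+2%:R <= 2 * n.+1%:R :> R by rewrite -natrM ler_nat; clear; lia.
have n20 : 0 < n.+2%:R :> R by [].
have n10 : 0 < n.+1%:R :> R by [].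
have n30 : 0 < n.+3%:R :> R by [].
move: G0 n1 n10 n20 n30.
have -> : n.+1%:R * n`!%:R * c * (r * r ^+ n) * (1 + e n.+1)
  = n.+1%:R * r * (n`!%:R * c * r ^+ n) * (1 + e n.+1).
  by move: (n`!%:R) (r ^+ n) (n.+1%:R) => *; ring.
have -> : r^-1 / 12 * (n.+3%:R * n.+2%:R * n.+1%:R * n`!%:R * c
               * (r ^+ 3 * r ^+ n) * (1 + e n.+3))
  = n.+3%:R * (n.+2%:R * (n.+1%:R * r ^+ 2 * (n`!%:R * c * r ^+ n)) * (1 + e n.+3) / 12).
  by move: (n`!%:R) (r ^+ n) (n.+1%:R) (n.+2%:R) (n.+3%:R) => *; field; rewrite gt_eqF.
move: (n`!%:R * c * r ^+ n) (n.+1%:R) (n.+2%:R) (n.+3%:R) => G N1 N2 N3.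
move: (e n) (e n.+1) (e n.+3) a0 a1 b0 b1 d0 d1 => x y w a0 a1 b0 b1 d0 d1 G0 N12 N10 N20 N30.
have H0 : 0 < N1 * r ^+ 2 * G by rewrite !mulr_gt0 ?exprn_gt0.
have -> : (N1 * r * G * (1 + y)) ^+ 2 = G * (N1 * (N1 * r ^+ 2 * G) * (1 + y) ^+ 2) by ring.
have -> : 2 * (G * (1 + x)) * a = G * (2 * (1 + x) * a) by ring.
rewrite ler_pM2l // ler_pM2l //.
move: (N1 * r ^+ 2 * G) H0 => H H0 main.
have y2 : 9 / 16 <= (1 + y) ^+ 2 by nra.
have NH : 0 < N1 * H by rewrite mulr_gt0.
have lo : N1 * H * (9 / 16) <= 2 * (1 + x) * a.
  by apply: le_trans main; rewrite ler_wpM2l // ltW.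
have a_ge0 : 0 <= a by rewrite -(pmulr_rge0 _ (_ : 0 < 2 * (1 + x))); nra.
have lo2 : N1 * H * (9 / 40) <= a by nra.
apply: le_trans lo2.
have U_le : N2 * H <= 2 * (N1 * H) by rewrite mulrA ler_wpM2r // ltW.
have U_w : N2 * H * (1 + w) <= N2 * H * (5 / 4) by rewrite ler_pM2l ?mulr_gt0 //; lra.
by move: (N2 * H) (N1 * H) NH U_le U_w => *; lra.
Qed.

Theorem theorem4p3 (R : realType) (k : nat) (hk : (3 <= k)%N)
    (r : R) (hr : is_growth_rate k r) :
  exists e : nat -> nat -> R,
    uniformO e (fun n => n%:R `^ (- (49 / 100))) /\
    forall m n : nat, (1 <= m <= n)%N ->
      n%:R * (f_first k m n)%:R / (f k n)%:R
      = phi k r (m%:R / n%:R) * (1 + e m n).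
Proof.
have [c [K [e [K0 sg]]]] := growth_rate_uniform hr; have [r0 c0 fE eK] := sg.
have k0 : (0 < k)%N by lia.
pose B := 4 * first_value_const r K.
have B0 : 0 <= B by rewrite mulr_ge0 // first_value_const_ge0.
have Br0 : 0 <= 24 * B * r by apply: mulr_ge0 (ltW r0); apply: mulr_ge0.
(* From N on, 4K <= n gives |e n| <= 1/4, and 24Br <= n makes the additive error
   B/n at most half of the lower bound 1/(12r). *)
pose N := Num.bound (4 * K + 24 * B * r).
have bnd (n : nat) : (N <= n)%N -> 4 * K + 24 * B * r <= n%:R.
  move=> Nn; apply: (@le_trans _ _ N%:R); last by rewrite ler_nat.
  by apply: ltW; apply: archi_boundP; rewrite addr_ge0 // mulr_ge0.
have e4 n : (N <= n)%N -> `|e n| <= 4^-1.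
  move=> /bnd bn; apply: le_trans (eK n) _; rewrite ler_pdivrMr ?ltr0Sn // -[n.+1%:R]natr1.
  by move: bn Br0; move: (n%:R) (24 * B * r) => ? ? ? ?; lra.
have approx n m : (N <= n)%N -> (1 <= m <= n)%N ->
    `|n%:R * (f_first k m n)%:R / (f k n)%:R - phi k r (m%:R / n%:R)| <= B / n%:R.
  move=> /e4 en; case: m => // m m_n; rewrite f_firstE.
  by apply: (phi_approx _ sg) => //; apply: le_trans en _; lra.
have phi_ge n m : (1 <= m <= n)%N -> r^-1 / 24 <= phi k r (m%:R / n%:R).
  move=> /andP[m0 m_n]; have n0 : (0 < n)%N by lia.
  (* phi sees m/n only, so (m,n) may be scaled up beyond the threshold; the
     offset 3 is for the lower bound, which speaks of n.+3. *)
  have -> : m%:R / n%:R = (m * N.+3)%:R / (n * N.+3)%:R :> R.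
    by rewrite !natrM invfM mulrACA divff ?mulr1 // pnatr_eq0.
  have N_n : (N.+3 <= n * N.+3)%N by rewrite leq_pmull.
  have m'n' : (1 <= m * N.+3 <= n * N.+3)%N by rewrite muln_gt0 m0 leq_mul2r m_n orbT.
  move: (n * N.+3)%N (m * N.+3)%N N_n m'n' => {m0 m_n n0}n {}m N_n m_n.
  have := approx n m (ltac:(lia)) m_n; rewrite ler_distlC => /andP[+ _].
  have lower : r^-1 / 12 <= n%:R * (f_first k m n)%:R / (f k n)%:R.
    case: n m m_n N_n => [|[|[|n]]] [|m] // m_n N_n; rewrite f_firstE.
    by apply: (first_value_lower _ sg) => //; apply: e4; lia.
  have Bn : B / n%:R <= r^-1 / 24.
    rewrite ler_pdivrMr ?ltr0n; last by lia.
    rewrite -ler_pdivrMl ?divr_gt0 ?invr_gt0 // invfM !invrK.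
    have := bnd n (ltac:(lia)); have : 0 <= 4 * K by rewrite mulr_ge0.
    rewrite (_ : 24 * B * r = r * 24 * B); last by ring.
    by move: (r * 24 * B) (4 * K) => *; lra.
  move: lower Bn; move: (r^-1) (B / n%:R) (phi _ _ _) (_ / (f k n)%:R) => *; lra.
have phi_gt0 n m : (1 <= m <= n)%N -> 0 < phi k r (m%:R / n%:R).
  by move=> /phi_ge; apply: lt_le_trans; rewrite divr_gt0 ?invr_gt0.
exists (fun m n => n%:R * (f_first k m n)%:R / (f k n)%:R / phi k r (m%:R / n%:R) - 1).
split; last first.
  move=> m n /phi_gt0 p0; rewrite [1 + _]addrC subrK [RHS]mulrC divfK //.
  by rewrite gt_eqF.
exists (24 * B * r), N.+1 => n m N_n m_n.
have p0 := phi_gt0 n m m_n; have pge := phi_ge n m m_n.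
have n0 : (0 < n)%N by lia.
have -> : n%:R * (f_first k m n)%:R / (f k n)%:R / phi k r (m%:R / n%:R) - 1
  = (n%:R * (f_first k m n)%:R / (f k n)%:R - phi k r (m%:R / n%:R))
      / phi k r (m%:R / n%:R).
  by rewrite mulrBl divff // gt_eqF.
rewrite normrM normfV (gtr0_norm p0) ler_pdivrMr //.
apply: le_trans (approx n m (ltnW N_n) m_n) _.
have pow : n%:R^-1 <= n%:R `^ (- (49 / 100)) :> R.
  by rewrite -powR_inv1 // ler_powR ?ler1n // lerN2; lra.
apply: (@le_trans _ _ (B * n%:R `^ (- (49 / 100)))); first by rewrite ler_wpM2l.
have -> : B * n%:R `^ (- (49 / 100)) = 24 * B * r * n%:R `^ (- (49 / 100)) * (r^-1 / 24).
  by move: (_ `^ _) => *; field; rewrite gt_eqF.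
by rewrite ler_wpM2l // mulr_ge0 ?powR_ge0.
Qed.
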